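(* Let $\mathbb{F}$ be a field with $\mathbb{F} \neq \mathbb{F}_2$. If $A$ is a $2n \times 2n$ matrix over $\mathbb{F}$ which is symplectic (i.e. $A^T \Omega A = \Omega$) and satisfies $A c_0 = c_0$, then $A \in EL_n(\mathbb{F})$.
   Context: Here $\Omega = \begin{pmatrix} 0 & -I \\ I & 0 \end{pmatrix}$ (with $n \times n$ blocks), so that the standard symplectic form on $\mathbb{F}^n \times \mathbb{F}^n$ is $\omega((x_1,x_2),(y_1,y_2)) = \langle x_2, y_1\rangle - \langle x_1, y_2 \rangle$, where $\langle x,y\rangle = \sum_j x_j y_j$. The vector $c_0 = (1,\dots,1,0,\dots,0) \in \mathbb{F}^{2n}$ has its first $n$ entries equal to $1$ and its last $n$ entries equal to $0$. Let $E_{i,j}$ denote the $n \times n$ matrix with a $1$ in entry $(i,j)$ and zeros elsewhere. For $a \in \mathbb{F}$ define the $2n \times 2n$ block matrices (with $n\times n$ blocks) $\Xi_j(a) = \begin{pmatrix} I & aE_{j,j} \\ 0 & I \end{pmatrix}$ for $j = 1,\dots,n$, and $\Xi_{i,j}(a) = \begin{pmatrix} I & 0 \\ a(E_{i,i} - E_{i,j} - E_{j,i} + E_{j,j}) & I \end{pmatrix}$ for $i \neq j$. The electrical linear group $EL_n(\mathbb{F})$ is the subgroup of $GL_{2n}(\mathbb{F})$ generated by all $\Xi_j(a)$ and all $\Xi_{i,j}(a)$ with $a \in \mathbb{F} \setminus \{0\}$ (these correspond to adjoining a boundary spike at vertex $j$, resp. a boundary edge between vertices $i$ and $j$, of weight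 $a$). *)

(* Defs.v *)
From mathcomp Require Import all_boot all_algebra.

Set Implicit Arguments.
Unset Strict Implicit.
Unset Printing Implicit Defensive.

Import GRing.Theory.
Local Open Scope ring_scope.

(* F may be infinite, so neither {group gT} nor 'GL_n[F] (both restricted to
   finite groups) can be used; subgroups of GL_m(F) are predicates on 'M[F]_m. *)

(* The subgroup of GL_m(F) generated by the invertible matrices satisfying S. *)
Inductive generated_subgroup (F : fieldType) (m : nat) (S : 'M[F]_m -> Prop) :
    'M[F]_m -> Prop :=
| gen_id : generated_subgroup S 1%:M
| gen_mem A : A \in unitmx -> S A -> generated_subgroup S A
| gen_mul A B : generated_subgroup S A -> generated_subgroup S B ->
    generated_subgroup S (A *m B)
| gen_inv A : generated_subgroup S A -> generated_subgroup S (invmx A).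

Section ElectricalLinearGroup.
Variables (F : fieldType) (n : nat).

(* 'M[F]_(n + n) rather than 'M[F]_(2 * n), for the block decomposition. *)
Definition Omega : 'M[F]_(n + n) := block_mx 0 (- 1%:M) 1%:M 0.

Definition symplectic (A : 'M[F]_(n + n)) : Prop := A^T *m Omega *m A = Omega.

Definition c0 : 'cV[F]_(n + n) := col_mx (const_mx 1) 0.

Definition Xi_spike (j : 'I_n) (a : F) : 'M[F]_(n + n) :=
  block_mx 1%:M (a *: delta_mx j j) 0 1%:M.

Definition Xi_edge (i j : 'I_n) (a : F) : 'M[F]_(n + n) :=
  block_mx 1%:M 0
    (a *: (delta_mx i i - delta_mx i j - delta_mx j i + delta_mx j j)) 1%:M.

Definition EL_generator (A : 'M[F]_(n + n)) : Prop :=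
  (exists j : 'I_n, exists a : F, a != 0 /\ A = Xi_spike j a) \/
  (exists i j : 'I_n, exists a : F, [/\ i != j, a != 0 & A = Xi_edge i j a]).

Definition EL : 'M[F]_(n + n) -> Prop := generated_subgroup EL_generator.

(* Hence the invertibility side condition in gen_mem excludes no generator. *)
Lemma EL_generator_unit (A : 'M[F]_(n + n)) : EL_generator A -> A \in unitmx.
Proof.
by case=> [[j [a [_ ->]]] | [i [j [a [_ _ ->]]]]];
  rewrite unitmxE ?det_ublock ?det_lblock !det1 mulr1 unitr1.
Qed.

End ElectricalLinearGroup.

Definition isomorphic_to_F2 (F : fieldType) : Prop :=
  exists f : {rmorphism 'F_2 -> F}, bijective f.

(* Main.v *)
Require Import Defs.
From HB Require Import structures.
From mathcomp Require Import all_boot all_algebra.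
From Stdlib Require Import Classical.

Set Implicit Arguments.
Unset Strict Implicit.
Unset Printing Implicit Defensive.

Import GRing.Theory.
Local Open Scope ring_scope.

(** The edge generators span all lower shears [[1, 0], [L, 1]] with [L] symmetric
    and [L 1 = 0].  Conjugating the spike at [i] by edges [ij] and a spike at [j]
    gives the transvection along [e_i + s e_j] for [s <> 0, 1]; such an [s] exists
    because [F] has more than two elements, and hence every upper shear
    [[1, S], [0, 1]] with [S] symmetric is available.  Given [A = [[P, Q], [R, T]]]
    in the stabilizer of [c0], rank one upper shears raise the rank of [P] until
    [P] is invertible.  A pair of shears then multiplies [P] on the left by
    [1 + S L], which can be any invertible [1 + x y] with [y 1 = 0]; choosing it
    well lowers the rank of [P - 1].  When [P = 1], [A] is a product of two shears. *)

(** * Preliminaries on scalars, double sums and linear functionals *)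

Lemma not_F2_scalar (F : fieldType) :
  ~ isomorphic_to_F2 F -> exists s : F, s != 0 /\ s != 1.
Proof.
move=> nF2; apply: NNPP => no_s; apply: nF2.
have F01 (x : F) : x = 0 \/ x = 1.
  case: (eqVneq x 0) => [|x0]; [by left | right].
  by apply/eqP/negP => /negP x1; apply: no_s; exists x.
have two0 : 1 + 1 = 0 :> F.
  by case: (F01 (1 + 1)) => // /eqP; rewrite -subr_eq0 addrK oner_eq0.
(* Now [F] is {0, 1} with 1 + 1 = 0, so sending residues to their representatives is a ring
   isomorphism. *)
pose f (x : 'F_2) : F := (x : nat)%:R.
have F2_01 (a : 'F_2) : a = 0 \/ a = 1.
  by case: a => [[|[|//]] ?]; [left | right]; apply: val_inj.
have f_add : zmod_morphism f.
  by move=> x y; case: (F2_01 x) => ->; case: (F2_01 y) => ->; rewrite /f /= ?subrr ?subr0 //;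
    rewrite sub0r; apply/eqP; rewrite -addr_eq0; apply/eqP.
have f_mul : monoid_morphism f.
  split=> // x y; case: (F2_01 x) => ->; case: (F2_01 y) => ->;
    by rewrite /f /= ?mulr0 ?mul0r ?mulr1.
pose fa := GRing.isZmodMorphism.Build _ _ f f_add.
pose fm := GRing.isMonoidMorphism.Build _ _ f f_mul.
pose fR : {rmorphism 'F_2 -> F} := HB.pack f fa fm.
exists fR; exists (fun x : F => if x == 0 then 0 else 1).
- case=> [[|[|?]] ?] //=; rewrite /f /= ?eqxx ?oner_eq0; exact: val_inj.
- by move=> x; case: (F01 x) => ->; rewrite ?eqxx ?oner_eq0.
Qed.

(** Serves to expand a symmetric matrix into diagonal terms and terms indexed by unordered pairs,
    each of which matches one shear. *)
Lemma sum_pairs (V : zmodType) (n : nat) (g : 'I_n -> 'I_n -> V) :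
  \sum_i \sum_j g i j =
    \sum_i g i i + \sum_(i : 'I_n) \sum_(j : 'I_n | (j < i)%N) (g i j + g j i).
Proof.
have split_row (i : 'I_n) : \sum_j g i j =
    g i i + (\sum_(j : 'I_n | (j < i)%N) g i j + \sum_(j : 'I_n | (i < j)%N) g i j).
  rewrite (bigD1 i) //= (bigID (fun j : 'I_n => (j < i)%N)) /=.
  by congr (_ + (_ + _)); apply: eq_bigl => j; rewrite -(inj_eq val_inj) /=; case: ltngtP.
rewrite (eq_bigr _ (fun i _ => split_row i)) !big_split /=; congr (_ + _).
rewrite (eq_bigr _ (fun i _ => big_split _ _ _ _ _)) big_split /=; congr (_ + _).
by rewrite (exchange_big_dep xpredT).
Qed.

(** Take coordinates detecting [a] and [b]. If each of them vanishes on the other vector, their sum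
    detects both. *)
Lemma row_nonzero_on (F : fieldType) (n : nat) (a b : 'cV[F]_n) :
  a != 0 -> b != 0 -> exists w : 'rV[F]_n, (w *m a) 0 0 != 0 /\ (w *m b) 0 0 != 0.
Proof.
move=> a0 b0.
have nz (c : 'cV[F]_n) : c != 0 -> exists i, c i 0 != 0.
  by case/cV0Pn => i ci; exists i.
have dE (i : 'I_n) (c : 'cV[F]_n) : ((delta_mx 0 i : 'rV_n) *m c) 0 0 = c i 0.
  by rewrite -rowE mxE.
have [[i ai] [j bj]] := (nz a a0, nz b b0).
have [bi|bi] := eqVneq (b i 0) 0; last by exists (delta_mx 0 i); rewrite !dE.
have [aj|aj] := eqVneq (a j 0) 0; last by exists (delta_mx 0 j); rewrite !dE.
exists (delta_mx 0 i + delta_mx 0 j).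
by rewrite !mulmxDl ![(_ + _ : 'M_(1,1)) 0 0]mxE !dE bi aj addr0 add0r.
Qed.

(** * Shears and the block form of the stabilizer conditions *)

Section ElectricalGroup.
Variables (F : fieldType) (n : nat).
Implicit Types (A B g : 'M[F]_(n + n)) (P Q R S L : 'M[F]_n).

Let one : 'cV[F]_n := const_mx 1.

Definition upper_shear S : 'M[F]_(n + n) := block_mx 1%:M S 0 1%:M.
Definition lower_shear L : 'M[F]_(n + n) := block_mx 1%:M 0 L 1%:M.

Lemma upper_shear_block S P Q R T :
  upper_shear S *m block_mx P Q R T = block_mx (P + S *m R) (Q + S *m T) R T.
Proof. by rewrite mulmx_block !mul1mx !mul0mx !add0r. Qed.

Lemma lower_shear_block L P Q R T :
  lower_shear L *m block_mx P Q R T = block_mx P Q (L *m P + R) (L *m Q + T).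
Proof. by rewrite mulmx_block !mul1mx !mul0mx !addr0. Qed.

Lemma upper_shearD S S' : upper_shear (S + S') = upper_shear S *m upper_shear S'.
Proof. by rewrite upper_shear_block mulmx0 mulmx1 addr0 addrC. Qed.

Lemma lower_shearD L L' : lower_shear (L + L') = lower_shear L *m lower_shear L'.
Proof. by rewrite lower_shear_block mulmx0 mulmx1 add0r. Qed.

Lemma upper_shear0 : upper_shear 0 = 1%:M.
Proof. by rewrite [RHS]scalar_mx_block. Qed.

Lemma lower_shear0 : lower_shear 0 = 1%:M.
Proof. by rewrite [RHS]scalar_mx_block. Qed.

Lemma upper_shearNK S A : upper_shear (- S) *m (upper_shear S *m A) = A.
Proof. by rewrite mulmxA -upper_shearD addNr upper_shear0 mul1mx. Qed.

Lemma lower_shearNK L A : lower_shear (- L) *m (lower_shear L *m A) = A.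
Proof. by rewrite mulmxA -lower_shearD addNr lower_shear0 mul1mx. Qed.

(** Since Omega^2 = -1, the matrix -Omega A^T Omega is a left inverse of [A]. *)
Lemma symplectic_unit A : symplectic A -> A \in unitmx.
Proof.
move=> sA.
have O2 : Omega F n *m Omega F n = - 1%:M.
  rewrite /Omega mulmx_block !mul0mx !mulmx0 !addr0 !add0r mulNmx mulmxN !mulmx1.
  by rewrite [in RHS]scalar_mx_block opp_block_mx !oppr0.
have : (- Omega F n *m A^T *m Omega F n) *m A = 1%:M.
  by rewrite -2!mulmxA (mulmxA A^T) sA mulNmx O2 opprK.
by case/mulmx1_unit.
Qed.

Lemma symplecticM A B : symplectic A -> symplectic B -> symplectic (A *m B).
Proof.
move=> sA sB; rewrite /symplectic trmx_mul -!mulmxA (mulmxA A^T).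
by rewrite (mulmxA (_ *m _)) sA mulmxA.
Qed.

Lemma symplectic_block P Q R T :
  symplectic (block_mx P Q R T) <->
  [/\ R^T *m P = P^T *m R, R^T *m Q - P^T *m T = - 1%:M,
      T^T *m P - Q^T *m R = 1%:M & T^T *m Q = Q^T *m T].
Proof.
rewrite /symplectic /Omega tr_block_mx !mulmx_block !mulmx0 !add0r !addr0 !mulmx1.
rewrite !mulmxN !mulmx1 !mulNmx.
split=> [/eq_block_mx [e1 e2 e3 e4]|[e1 e2 e3 e4]].
  by split; rewrite //; apply/eqP; rewrite -subr_eq0 ?e1 ?e4.
by rewrite e1 e2 e3 e4 !subrr.
Qed.

Lemma upper_shear_symplectic S : S^T = S -> symplectic (upper_shear S).
Proof.
move=> sS; apply/symplectic_block.
by rewrite !trmx0 !trmx1 !mul0mx !mulmx0 !mul1mx !mulmx1 sS subr0 sub0r.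
Qed.

Lemma lower_shear_symplectic L : L^T = L -> symplectic (lower_shear L).
Proof.
move=> sL; apply/symplectic_block.
by rewrite !trmx0 !trmx1 !mul0mx !mulmx0 !mul1mx !mulmx1 sL subr0 sub0r.
Qed.

Lemma block_fix_c0 P Q R T :
  block_mx P Q R T *m c0 F n = c0 F n <-> P *m one = one /\ R *m one = 0.
Proof.
rewrite /c0 mul_block_col !mulmx0 !addr0.
by split=> [/eq_col_mx|[-> ->]].
Qed.

(** * Shears generated by spikes and edges *)

Lemma EL_spike j (a : F) : EL (upper_shear (a *: delta_mx j j)).
Proof.
have [->|a0] := eqVneq a 0; first by rewrite scale0r upper_shear0; apply: gen_id.
have gA : EL_generator (Xi_spike j a) by left; exists j, a.
exact: gen_mem (EL_generator_unit gA) gA.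
Qed.

Definition edge_mx (i j : 'I_n) : 'M[F]_n :=
  delta_mx i i - delta_mx i j - delta_mx j i + delta_mx j j.

Lemma EL_edge i j (a : F) : i != j -> EL (lower_shear (a *: edge_mx i j)).
Proof.
move=> ij; have [->|a0] := eqVneq a 0; first by rewrite scale0r lower_shear0; apply: gen_id.
have gA : EL_generator (Xi_edge i j a) by right; exists i, j, a.
exact: gen_mem (EL_generator_unit gA) gA.
Qed.

Lemma EL_upper_shearD S S' :
  EL (upper_shear S) -> EL (upper_shear S') -> EL (upper_shear (S + S')).
Proof. by move=> ? ?; rewrite upper_shearD; apply: gen_mul. Qed.

Lemma EL_lower_shearD L L' :
  EL (lower_shear L) -> EL (lower_shear L') -> EL (lower_shear (L + L')).
Proof. by move=> ? ?; rewrite lower_shearD; apply: gen_mul. Qed.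

Lemma EL_lower_shear L : L^T = L -> L *m one = 0 -> EL (lower_shear L).
Proof.
move=> sL L1.
have Lji i j : L j i = L i j by rewrite -[in LHS]sL mxE.
(* The subtracted terms add up to zero because the row sums of [L] vanish. The terms for (i, j) and
   (j, i) then combine into an edge of weight -L_ij. *)
have -> : L = \sum_i \sum_j L i j *: (delta_mx i j - delta_mx i i).
  under eq_bigr => i _ do under eq_bigr => j _ do rewrite scalerBr.
  under eq_bigr => i _ do rewrite sumrB -scaler_suml.
  rewrite sumrB -matrix_sum_delta [X in _ - X]big1 ?subr0 // => i _.
  have /matrixP/(_ i 0) := L1; rewrite !mxE => Li.
  rewrite (eq_bigr (fun j => L i j * one j 0)) ?Li ?scale0r // => j _.
  by rewrite mxE mulr1.
rewrite sum_pairs big1 ?add0r; last by move=> i _; rewrite subrr scaler0.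
have e0 : EL (lower_shear 0) by rewrite lower_shear0; apply: gen_id.
apply: (big_ind (fun M => EL (lower_shear M))) => //; first exact: EL_lower_shearD.
move=> i _; apply: (big_ind (fun M => EL (lower_shear M))) => //; first exact: EL_lower_shearD.
move=> j ji.
have -> : L i j *: (delta_mx i j - delta_mx i i) + L j i *: (delta_mx j i - delta_mx j j)
    = (- L i j) *: edge_mx i j.
  rewrite Lji -scalerDr scaleNr -scalerN; congr (_ *: _).
  by rewrite /edge_mx !opprD !opprK -!addrA addrCA.
by apply: EL_edge; rewrite -(inj_eq val_inj) /= gtn_eqF.
Qed.

(* With [v = col_mx p 0], [upper_shear (t *: (p *m p^T))] is the transvection
   [x |-> x - t (v^T Omega x) v]; conjugating it by [g] moves [v] to [g v]. *)
Lemma EL_upper_shear_conj g (p q : 'cV[F]_n) (t : F) :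
  symplectic g -> EL g -> g *m col_mx p 0 = col_mx q 0 ->
  EL (upper_shear (t *: (p *m p^T))) -> EL (upper_shear (t *: (q *m q^T))).
Proof.
move=> sg Eg gp Ep.
have ug := symplectic_unit sg.
have transv (r : 'cV[F]_n) : upper_shear (t *: (r *m r^T)) =
    1%:M - t *: (col_mx r 0 *m ((col_mx r 0)^T *m Omega F n)).
  rewrite tr_col_mx trmx0 /Omega mul_row_block !mulmx0 !mul0mx !addr0 mulmxN mulmx1.
  rewrite mul_col_row !mulmx0 !mul0mx scale_block_mx !scaler0 scalar_mx_block.
  by rewrite opp_block_mx add_block_mx !oppr0 !addr0 add0r mulmxN scalerN opprK.
suff -> : upper_shear (t *: (q *m q^T)) =
    g *m upper_shear (t *: (p *m p^T)) *m invmx g.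
  by apply: gen_mul (gen_inv Eg); apply: gen_mul.
(* With the inverse cleared, the claim reduces to (g v)^T Omega g = v^T Omega. *)
apply: (can_inj (mulmxK ug)); rewrite mulmxKV //.
rewrite !transv mulmxBl mulmxBr mul1mx mulmx1 -scalemxAl -scalemxAr; congr (_ - _ *: _).
by rewrite -gp trmx_mul -!mulmxA (mulmxA g^T) sg.
Qed.

(** For q = e_i + s e_j, the matrix (a/s) q q^T has off-diagonal part a (E_ij + E_ji); spikes of
    weights -a/s and -as cancel its diagonal. *)
Lemma EL_upper_pair (s a : F) (i j : 'I_n) : s != 0 -> s != 1 -> i != j ->
  EL (upper_shear (a *: (delta_mx i j + delta_mx j i))).
Proof.
move=> s0 s1 ij.
have ji : j != i by rewrite eq_sym.
pose e k : 'cV[F]_n := delta_mx k 0.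
have edge_i : edge_mx i j *m e i = e i - e j.
  by rewrite /edge_mx !(mulmxDl, mulNmx) !mul_delta_mx !mul_delta_mx_0 // subr0 addr0.
have edge_j : edge_mx i j *m e j = e j - e i.
  rewrite /edge_mx !(mulmxDl, mulNmx) !mul_delta_mx !mul_delta_mx_0 // subr0 add0r.
  by rewrite addrC.
have edge_sym : (edge_mx i j)^T = edge_mx i j.
  by rewrite /edge_mx !linearD /= !linearN /= !trmx_delta -!addrA; congr (_ + _); rewrite addrCA.
(* The first two factors applied send (e_i, 0) to (e_i + s e_j, e_i - e_j). The last edge adds c (1
   - s) (e_i - e_j) to the lower half, and this [c] makes it vanish. *)
pose c := - (1 - s)^-1.
pose g := lower_shear (c *: edge_mx i j) *m
  (upper_shear ((- s) *: delta_mx j j) *m lower_shear (1 *: edge_mx i j)).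
have sg : symplectic g.
  by apply: symplecticM; [|apply: symplecticM]; [apply: lower_shear_symplectic
    |apply: upper_shear_symplectic|apply: lower_shear_symplectic];
    rewrite linearZ /= ?edge_sym ?trmx_delta.
have Eg : EL g.
  by apply: gen_mul; [|apply: gen_mul]; [apply: EL_edge|apply: EL_spike|apply: EL_edge].
have ge : g *m col_mx (e i) 0 = col_mx (e i + s *: e j) 0.
  rewrite /g -!mulmxA !mul_block_col !mul1mx !mul0mx !addr0 scale1r edge_i.
  have -> : e i + (- s) *: delta_mx j j *m (e i - e j) = e i + s *: e j.
    rewrite -scalemxAl mulmxBr mul_delta_mx mul_delta_mx_0 // sub0r.
    by rewrite scalerN scaleNr opprK.
  congr col_mx; rewrite -scalemxAl mulmxDr -scalemxAr edge_i edge_j.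
  rewrite -(opprB (e i)) scalerN -{1}[e i - e j]scale1r -scalerBl scalerA.
  have s1' : 1 - s != 0 by rewrite subr_eq0 eq_sym.
  by rewrite /c mulNr mulVf // scaleN1r add0r addNr.
have spike t k : EL (upper_shear (t *: delta_mx k k)) by apply: EL_spike.
have spike_i : EL (upper_shear ((a / s) *: (e i *m (e i)^T))).
  by rewrite trmx_delta mul_delta_mx.
have := EL_upper_shear_conj sg Eg ge spike_i.
move/EL_upper_shearD/(_ (spike (- (a / s)) i)).
move/EL_upper_shearD/(_ (spike (- (a * s)) j)).
congr (EL (upper_shear _)).
rewrite linearD linearZ /= !trmx_delta mulmxDl !mulmxDr -!scalemxAl -!scalemxAr !mul_delta_mx.
rewrite !scalerDr !scalerA divfK // !scaleNr.
by rewrite [LHS]addrAC addrA addrK -!addrA [LHS]addrC -!addrA addNr addr0.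
Qed.

Lemma EL_upper_shear (s : F) S : s != 0 -> s != 1 -> S^T = S -> EL (upper_shear S).
Proof.
move=> s0 s1 sS.
have Sji i j : S j i = S i j by rewrite -[in LHS]sS mxE.
rewrite [S]matrix_sum_delta sum_pairs.
have e0 : EL (upper_shear 0) by rewrite upper_shear0; apply: gen_id.
apply: EL_upper_shearD; apply: (big_ind (fun M => EL (upper_shear M))) => //;
  try exact: EL_upper_shearD.
  by move=> i _; apply: EL_spike.
move=> i _; apply: (big_ind (fun M => EL (upper_shear M))) => //; first exact: EL_upper_shearD.
move=> j ji; rewrite Sji -scalerDr; apply: (EL_upper_pair _ s0 s1).
by rewrite -(inj_eq val_inj) /= gtn_eqF.
Qed.

(** * Reduction of a stabilizer matrix by shears *)

Lemma stabilizer_upper S A :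
  S^T = S -> symplectic A -> A *m c0 F n = c0 F n ->
  symplectic (upper_shear S *m A) /\ upper_shear S *m A *m c0 F n = c0 F n.
Proof.
move=> sS sA A1; split; first exact: symplecticM (upper_shear_symplectic sS) sA.
by rewrite -mulmxA A1; apply/block_fix_c0; rewrite mul1mx mul0mx.
Qed.

Lemma stabilizer_lower L A :
  L^T = L -> L *m one = 0 -> symplectic A -> A *m c0 F n = c0 F n ->
  symplectic (lower_shear L *m A) /\ lower_shear L *m A *m c0 F n = c0 F n.
Proof.
move=> sL L1 sA A1; split; first exact: symplecticM (lower_shear_symplectic sL) sA.
by rewrite -mulmxA A1; apply/block_fix_c0; rewrite mul1mx.
Qed.

(** With P = 1 the symplectic equations make [R] symmetric, and fixing [c0] gives R 1 = 0, so a
    lower shear clears [R]. The same equations then force T = 1 and a symmetric upper right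
    block. *)
Lemma EL_stabilizer_ul1 Q R T :
  (forall S, S^T = S -> EL (upper_shear S)) ->
  symplectic (block_mx 1%:M Q R T) -> block_mx 1%:M Q R T *m c0 F n = c0 F n ->
  EL (block_mx 1%:M Q R T).
Proof.
move=> EU sA A1.
have [/esym + _ _ _] := (symplectic_block _ _ _ _).1 sA.
rewrite trmx1 mul1mx mulmx1 => sR.
have [_ R1] := (block_fix_c0 _ _ _ _).1 A1.
have sNR : (- R)^T = - R by rewrite linearN /= -sR.
have NR1 : - R *m one = 0 by rewrite mulNmx R1 oppr0.
have [sB _] := stabilizer_lower sNR NR1 sA A1.
rewrite -(lower_shearNK (- R) (block_mx _ _ _ _)) opprK.
apply: gen_mul; first by apply: EL_lower_shear.
move: sB; rewrite lower_shear_block mulmx1 addNr => /symplectic_block[_ _].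
rewrite mulmx1 mulmx0 subr0 => T1; rewrite -[- R *m Q + T]trmxK T1 !trmx1 mul1mx mulmx1 => sQ.
exact: EU.
Qed.

Lemma EL_stabilizer_unit P Q R T :
  (forall S, S^T = S -> EL (upper_shear S)) -> P \in unitmx ->
  symplectic (block_mx P Q R T) -> block_mx P Q R T *m c0 F n = c0 F n ->
  EL (block_mx P Q R T).
Proof.
move=> EU; have [m] := ubnP (\rank (P - 1%:M)).
elim: m P Q R T => // m IH P Q R T rkP uP sA A1.
have [/subr0_eq P1|D0] := eqVneq (P - 1%:M) 0.
  by rewrite P1 in sA A1 *; apply: EL_stabilizer_ul1.
set D := P - 1%:M in rkP D0 *.
have [Pone Rone] := (block_fix_c0 _ _ _ _).1 A1.
have [PR _ _ _] := (symplectic_block _ _ _ _).1 sA.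
have Done : D *m one = 0 by rewrite mulmxBl mul1mx Pone subrr.
have PD : P *m D = D *m P by rewrite mulmxBl mulmxBr mul1mx mulmx1.
have [v Dv] : exists v : 'cV_n, D *m v != 0.
  have [i [j Dij]] : exists i j, D i j != 0 by apply/matrix0Pn.
  by exists (delta_mx j 0); apply/cV0Pn; exists i; rewrite -colE mxE.
have PDv : invmx P *m (D *m v) != 0.
  by apply: contraNneq Dv => PDv; rewrite -(mulKVmx uP (D *m v)) PDv mulmx0.
(* Being nonzero on D v allows the rank reduction; being nonzero on P^-1 D v makes 1 + x y
   invertible. *)
have [w [wDv wPDv]] := row_nonzero_on Dv PDv.
set d := (w *m (D *m v)) 0 0 in wDv.
have dE : w *m (D *m v) = d%:M by rewrite [LHS]mx11_scalar.
pose y := w *m invmx P *m D.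
have yP : y *m P = w *m D.
  by rewrite /y -mulmxA -PD mulmxA mulmxKV.
(* With these choices [(1 + x y) P - 1 = D - (D v) (w D) / (w D v)]: Wedderburn's
   rank reduction of [D]. *)
pose x := - d^-1 *: (D *m v).
pose z := d^-1 *: (P *m v).
have yz : y *m z = 1%:M.
  by rewrite /z -scalemxAr mulmxA yP -mulmxA dE scale_scalar_mx mulVf.
have yone : y *m one = 0 by rewrite -mulmxA Done mulmx0.
have zy : z^T *m y^T = 1%:M by rewrite -trmx_mul yz trmx1.
have [q qE sq] : exists2 q, x^T *m y^T = q & q^T = q.
  by exists (x^T *m y^T); rewrite // [x^T *m y^T]mx11_scalar tr_scalar_mx.
(* The symmetric solution of [S y^T = x], given [y z = 1]. *)
pose S := x *m z^T + z *m x^T - z *m q *m z^T.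
have sS : S^T = S.
  rewrite /S linearB linearD /= !trmx_mul !trmxK sq mulmxA.
  by rewrite [z *m x^T + _]addrC.
pose L := y^T *m y.
have sL : L^T = L by rewrite trmx_mul trmxK.
have Lone : L *m one = 0 by rewrite -mulmxA yone mulmx0.
have SL : S *m L = x *m y.
  rewrite /L mulmxA; congr (_ *m _).
  by rewrite mulmxBl mulmxDl -!mulmxA zy qE !mulmx1 addrK.
pose c := (y *m x) 0 0.
have cE : y *m x = c%:M by rewrite [LHS]mx11_scalar.
(* Substituting D = P - 1 in y x = - d^-1 w P^-1 D (D v) gives 1 + y x = d^-1 w P^-1 D v. *)
have c1 : 1 + c != 0.
  have -> : 1 + c = d^-1 * (w *m (invmx P *m (D *m v))) 0 0.
    have DDv : D *m (D *m v) = P *m (D *m v) - D *m v.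
      by rewrite {1}/D mulmxBl mul1mx.
    suff -> : c = d^-1 * (w *m (invmx P *m (D *m v))) 0 0 - 1 by rewrite addrC subrK.
    rewrite /c /x -scalemxAr mxE /y -!mulmxA DDv mulmxBr mulKmx // mulmxBr dE.
    by rewrite !mxE mulr1n mulrBr !mulNr mulVf // opprK addrC.
  by rewrite mulf_neq0 ?invr_eq0.
have uM : 1%:M + x *m y \in unitmx.
  (* The Sherman-Morrison inverse. *)
  have : (1%:M + x *m y) *m (1%:M - (1 + c)^-1 *: (x *m y)) = 1%:M.
    rewrite mulmxBr mulmx1 -scalemxAr mulmxDl mul1mx -(mulmxA x y) (mulmxA y) cE.
    rewrite mul_scalar_mx -scalemxAr -{2}[x *m y]scale1r -scalerDl scalerA.
    by rewrite mulVf // scale1r addrK.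
  by case/mulmx1_unit.
(* This shear replaces [R] by L P, so the upper shear by [S] then turns [P] into (1 + S L) P. *)
pose L0 := L - R *m invmx P.
have sRP : (R *m invmx P)^T = R *m invmx P.
  have uPT : P^T \in unitmx by rewrite unitmx_tr.
  apply: (can_inj (mulmxK uP)); apply: (can_inj (mulKmx uPT)).
  by rewrite mulmxKV // -PR trmx_mul -mulmxA trmx_inv mulKVmx.
have RPone : R *m invmx P *m one = 0 by rewrite -Pone -mulmxA mulKmx.
have sL0 : L0^T = L0 by rewrite linearB /= sL sRP.
have L0one : L0 *m one = 0 by rewrite mulmxBl Lone RPone subrr.
have [sB B1] := stabilizer_lower sL0 L0one sA A1.
have [sC C1] := stabilizer_upper sS sB B1.
rewrite -(lower_shearNK L0 (block_mx _ _ _ _)); apply: gen_mul.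
  by apply: EL_lower_shear; rewrite ?linearN /= ?sL0 ?mulNmx ?L0one ?oppr0.
rewrite -(upper_shearNK S (_ *m _)); apply: gen_mul.
  by apply: EU; rewrite linearN /= sS.
move: sC C1; rewrite lower_shear_block upper_shear_block.
have -> : L0 *m P + R = L *m P by rewrite mulmxBl mulmxKV // subrK.
have -> : P + S *m (L *m P) = (1%:M + x *m y) *m P by rewrite mulmxA SL mulmxDl mul1mx.
move=> sC C1; apply: IH => //; last by rewrite unitmx_mul uM.
rewrite -ltnS; apply: leq_trans rkP; rewrite ltnS.
have newD : (1%:M + x *m y) *m P - 1%:M = (1%:M - d^-1 *: (D *m v *m w)) *m D.
  rewrite mulmxDl mul1mx addrAC -/D mulmxBl mul1mx; congr (_ + _).
  by rewrite -mulmxA yP /x -scalemxAl scaleNr -scalemxAl !mulmxA.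
(* The row space shrinks strictly: the new difference kills [v], whereas D v is nonzero. *)
apply: rank_ltmx; rewrite newD ltmxE submxMl /=.
apply/negP => /submxP [X DX]; case/negP: Dv.
rewrite DX -!mulmxA mulmxBl mul1mx -scalemxAl -!mulmxA dE mul_mx_scalar.
by rewrite -scalemxAr scalerA mulVf // scale1r subrr mulmx0.
Qed.

(** If P k = 0 with [k] nonzero, injectivity of [A] gives R k nonzero. For a row [z] with z R k
    nonzero, the shear by z^T z keeps the column space of [P] and adds the direction z^T. *)
Lemma EL_stabilizer A :
  (forall S, S^T = S -> EL (upper_shear S)) ->
  symplectic A -> A *m c0 F n = c0 F n -> EL A.
Proof.
move=> EU; have [m] := ubnP (n - \rank (ulsubmx A)).
elim: m A => // m IH A; rewrite -{2 3 4}(submxK A).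
set P := ulsubmx A; set Q := ursubmx A; set R := dlsubmx A; set T := drsubmx A.
move=> rkA sA A1.
have [uP|nuP] := boolP (P \in unitmx); first exact: EL_stabilizer_unit.
have [PR _ _ _] := (symplectic_block _ _ _ _).1 sA.
have [k k0 Pk] : exists2 k : 'cV_n, k != 0 & P *m k = 0.
  have : kermx P^T != 0 by rewrite kermx_eq0 row_free_unit unitmx_tr.
  case/rowV0Pn => u /sub_kermxP uP u0.
  by exists u^T; rewrite ?trmx_eq0 // -[P]trmxK -trmx_mul uP trmx0.
have Rk : R *m k != 0.
  apply: contraNneq k0 => Rk; have uA := symplectic_unit sA.
  have : block_mx P Q R T *m col_mx k 0 = 0.
    by rewrite mul_block_col !mulmx0 !addr0 Pk Rk col_mx0.
  move/(congr1 (mulmx (invmx (block_mx P Q R T)))).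
  by rewrite mulKmx // mulmx0 -[RHS]col_mx0 => /eq_col_mx[->].
have [z [zRk _]] := row_nonzero_on Rk Rk.
set d := (z *m (R *m k)) 0 0 in zRk.
have dE : z *m (R *m k) = d%:M by rewrite [LHS]mx11_scalar.
pose S := z^T *m z.
have sS : S^T = S by rewrite trmx_mul trmxK.
have [sB B1] := stabilizer_upper sS sA A1.
rewrite -(upper_shearNK S (block_mx _ _ _ _)); apply: gen_mul.
  by apply: EU; rewrite linearN /= sS.
move: sB B1; rewrite upper_shear_block.
set P' := P + S *m R => sB B1; apply: IH => //; rewrite block_mxKul.
rewrite -ltnS; apply: leq_trans rkA; rewrite ltnS.
suff rk : (\rank P < \rank P')%N.
  by rewrite ltn_sub2l // (leq_trans rk) // rank_leq_row.
(* Transposing turns the comparison of column spaces into one of row spaces, as [ltmx] requires. *)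
rewrite -mxrank_tr -(mxrank_tr P'); apply: rank_ltmx.
have P'k : P' *m k = d *: z^T.
  by rewrite mulmxDl Pk add0r -!mulmxA dE mul_mx_scalar.
have PP' : P = P' *m (1%:M - d^-1 *: (k *m (z *m R))).
  rewrite mulmxBr mulmx1 -scalemxAr (mulmxA P') P'k -scalemxAl scalerA mulVf // scale1r.
  by rewrite /P' /S mulmxA addrK.
rewrite ltmxE; apply/andP; split; first by rewrite {1}PP' trmx_mul submxMl.
apply/negP => /submxP [X P'X].
(* By R^T P = P^T R, the vector R k is orthogonal to the columns of [P]; its product with P' k is
   d^2, so P' k lies outside their span. *)
have RkP : (R *m k)^T *m P = 0.
  by rewrite trmx_mul -mulmxA PR mulmxA -trmx_mul Pk trmx0 mul0mx.
have P'PX : P' = P *m X^T by rewrite -[P']trmxK P'X trmx_mul trmxK.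
have : (R *m k)^T *m (P' *m k) = 0 by rewrite P'PX -mulmxA mulmxA RkP mul0mx.
rewrite P'k -scalemxAr -trmx_mul dE tr_scalar_mx scale_scalar_mx.
by move/matrixP/(_ 0 0)/eqP; rewrite !mxE mulr1n mulf_eq0 (negPf zRk).
Qed.

End ElectricalGroup.

Theorem mainTheorem11 (F : fieldType) (n : nat) (A : 'M[F]_(n + n)) :
  ~ isomorphic_to_F2 F ->
  symplectic A ->
  A *m c0 F n = c0 F n ->
  EL A.
Proof.
case/not_F2_scalar => s [s0 s1]; apply: EL_stabilizer => S.
exact: EL_upper_shear s0 s1.
Qed.
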